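(* Let $\mathcal{A}$ be a separable unital C*-algebra and $\mathcal{B}$ a unital C*-algebra, and let $\mathcal{A}_1\subset\mathcal{A}_2\subset\cdots\subset\mathcal{A}$ be C*-subalgebras with $\mathcal{A}=\left[\bigcup_{n\in\mathbb{N}}\mathcal{A}_n\right]^-$. Suppose $\pi,\rho\in\mathrm{Rep}(\mathcal{A},\mathcal{B})$ are such that for every $n\in\mathbb{N}$: (1) $\rho|_{\mathcal{A}_n}\in\mathcal{U}_{\mathcal{B}}(\pi|_{\mathcal{A}_n})$, i.e. there is a unitary $U\in\mathcal{B}$ with $U^*\pi(a)U=\rho(a)$ for all $a\in\mathcal{A}_n$; and (2) the unitary group of the relative commutant $\rho(\mathcal{A}_n)'\cap\mathcal{B}$ is connected. Then there is a strong internal path from $\pi$ to $\rho$.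
   Context: $\mathrm{Rep}(\mathcal{A},\mathcal{B})$ is the set of unital $*$-homomorphisms $\mathcal{A}\to\mathcal{B}$ with the topology of pointwise norm convergence. $\mathcal{U}_{\mathcal{B}}$ is the unitary group of $\mathcal{B}$ and $\mathcal{U}_{\mathcal{B}}(\pi)=\{U^*\pi(\cdot)U:U\in\mathcal{U}_{\mathcal{B}}\}$. A strong internal path from $\pi$ to $\rho$ is a norm-continuous map $\gamma:[0,1)\to\mathcal{U}_{\mathcal{B}}$ such that $\lim_{t\to1^-}\|\gamma(t)^*\pi(a)\gamma(t)-\rho(a)\|=0$ for every $a\in\mathcal{A}$. *)

(* Defs.v *)
From mathcomp Require Import all_boot all_algebra all_classical all_reals all_analysis.
From mathcomp Require Import all_order complex.
Import Order.TTheory GRing.Theory Num.Theory.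
Import numFieldNormedType.Exports.
Set Implicit Arguments. Unset Strict Implicit. Unset Printing Implicit Defensive.
Local Open Scope classical_set_scope.
Local Open Scope ring_scope.
Local Open Scope complex_scope.

Record is_unital_cstar_algebra (R : realType) (B : completeNormedModType R[i])
    (mul : B -> B -> B) (one : B) (star : B -> B) : Prop := {
  cs_mulA : forall x y z, mul x (mul y z) = mul (mul x y) z;
  cs_mul1l : forall x, mul one x = x;
  cs_mul1r : forall x, mul x one = x;
  cs_mulDl : forall x y z, mul (x + y) z = mul x z + mul y z;
  cs_mulDr : forall x y z, mul x (y + z) = mul x y + mul x z;
  cs_mulZl : forall (c : R[i]) x y, mul (c *: x) y = c *: mul x y;
  cs_mulZr : forall (c : R[i]) x y, mul x (c *: y) = c *: mul x y;
  cs_norm_mul : forall x y, `|mul x y| <= `|x| * `|y|;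
  cs_starK : forall x, star (star x) = x;
  cs_starD : forall x y, star (x + y) = star x + star y;
  cs_starZ : forall (c : R[i]) x, star (c *: x) = c^* *: star x;
  cs_starM : forall x y, star (mul x y) = mul (star y) (star x);
  cs_cstar : forall x, `|mul (star x) x| = `|x| ^+ 2
}.

Definition separable (T : topologicalType) : Prop :=
  exists D : set T, countable D /\ closure D = setT.

(* C*-subalgebra (not required to contain the unit): a norm-closed
   *-subalgebra. *)
Definition is_cstar_subalgebra (R : realType) (A : completeNormedModType R[i])
    (mul : A -> A -> A) (star : A -> A) (S : set A) : Prop :=
  S 0 /\
  (forall x y, S x -> S y -> S (x + y)) /\
  (forall (c : R[i]) x, S x -> S (c *: x)) /\
  (forall x y, S x -> S y -> S (mul x y)) /\
  (forall x, S x -> S (star x)) /\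
  closed S.

Definition is_unital_star_hom (R : realType)
    (A B : completeNormedModType R[i])
    (mulA : A -> A -> A) (oneA : A) (starA : A -> A)
    (mulB : B -> B -> B) (oneB : B) (starB : B -> B) (f : A -> B) : Prop :=
  [/\ (forall x y, f (x + y) = f x + f y),
      (forall (c : R[i]) x, f (c *: x) = c *: f x),
      (forall x y, f (mulA x y) = mulB (f x) (f y)),
      (forall x, f (starA x) = starB (f x)) &
      f oneA = oneB].

Definition cs_unitary (R : realType) (B : completeNormedModType R[i])
    (mul : B -> B -> B) (one : B) (star : B -> B) (u : B) : Prop :=
  mul (star u) u = one /\ mul u (star u) = one.

Definition unitary_group_rel_commutant (R : realType)
    (A B : completeNormedModType R[i])
    (mulB : B -> B -> B) (oneB : B) (starB : B -> B)
    (rho : A -> B) (S : set A) : set B :=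
  [set u | cs_unitary mulB oneB starB u /\
           forall a, S a -> mulB u (rho a) = mulB (rho a) u].

(* Strong internal path from pi to rho: a norm-continuous path
   gamma : [0,1) -> U_B with gamma(t)^* pi(a) gamma(t) -> rho(a) as t -> 1^-,
   the limit taken in the norm topology of B (gamma is extended arbitrarily
   outside [0,1); only its values on [0,1) matter). *)
Definition strong_internal_path (R : realType)
    (A B : completeNormedModType R[i])
    (mulB : B -> B -> B) (oneB : B) (starB : B -> B)
    (pi rho : A -> B) : Prop :=
  exists gamma : R -> B,
    (forall t : R, `[0, 1[%classic t -> cs_unitary mulB oneB starB (gamma t)) /\
    {within `[0, 1[%classic, continuous gamma} /\
    (forall a : A,
       mulB (mulB (starB (gamma t)) (pi a)) (gamma t)
         @[t --> 1^'-] --> rho a).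

(* Main.v *)
(** Let [U n] conjugate [pi] to [rho] on [An n]. Then [U n ^* U n.+1] commutes with
    [rho (An n)], and a connected unitary group [G n] of the relative commutant
    contains a path from [1] to it: the elements joined to [1] form a subgroup of
    [G n] that contains a neighbourhood of [1], hence is open and closed.
    Concatenating the paths multiplied by [U n] gives [gamma], defined on [0, oo)
    before reparametrization, with [gamma s ^* pi a gamma s = rho a] for all [a]
    in [An n] and [s >= n]; density and the boundedness of *-homomorphisms give
    the limit for all [a].

    Both analytic ingredients, small paths of unitaries and the boundedness of
    *-homomorphisms, need no spectral theory: for skew-adjoint [k] of norm at most
    [1/2], a fixed-point iteration yields a self-adjoint [x] with
    [(1 - x)^2 = 1 + k^2] in the bicommutant of [k], and then [k + (1 - x)] is
    unitary. *)
Require Import Defs.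
From mathcomp Require Import all_boot all_order all_algebra all_classical all_reals all_analysis.
From mathcomp Require Import complex lra.
Import Order.TTheory GRing.Theory Num.Theory.
Import numFieldNormedType.Exports.
Set Implicit Arguments. Unset Strict Implicit. Unset Printing Implicit Defensive.
Local Open Scope classical_set_scope.
Local Open Scope ring_scope.
Local Open Scope complex_scope.

(** * Real-valued norms and limits in complex normed spaces *)

Section RealNorm.
Context {R : realType} {V : normedModType R[i]}.
Implicit Types (v w : V) (t : R).

(* The norm of [V] takes its values in the partially ordered field [R[i]]. *)
Definition nrm v : R := complex.Re `|v|.

Lemma nrmE v : `|v| = (nrm v)%:C.
Proof. by rewrite /nrm RRe_real // normr_real. Qed.

Lemma nrm_ge0 v : 0 <= nrm v.
Proof. by have := normr_ge0 v; rewrite nrmE (lecR 0). Qed.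

Lemma nrm0 : nrm 0 = 0.
Proof. by rewrite /nrm normr0. Qed.

Lemma nrm_eq0 v : nrm v = 0 -> v = 0.
Proof. by move=> h; apply/eqP; rewrite -normr_eq0 nrmE h. Qed.

Lemma nrmN v : nrm (- v) = nrm v.
Proof. by rewrite /nrm normrN. Qed.

Lemma nrmD v w : nrm (v + w) <= nrm v + nrm w.
Proof. by have := ler_normD v w; rewrite !nrmE -rmorphD lecR. Qed.

Lemma nrmB v w : nrm (v - w) <= nrm v + nrm w.
Proof. by rewrite -(nrmN w) nrmD. Qed.

Lemma nrmBC v w : nrm (v - w) = nrm (w - v).
Proof. by rewrite -nrmN opprB. Qed.

Lemma nrmZ t v : nrm (t%:C *: v) = `|t| * nrm v.
Proof.
apply: complexI; rewrite -nrmE normrZ nrmE rmorphM /=; congr (_ * _).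
by rewrite normc_def /= expr0n /= addr0 sqrtr_sqr.
Qed.

Lemma nrmZi v : nrm ('i *: v) = nrm v.
Proof.
apply: complexI; rewrite -nrmE normrZ normc_def /= expr0n expr1n /= add0r.
by rewrite sqrtr1 mul1r nrmE.
Qed.

Lemma nrmDD v : nrm (v + v) = nrm v + nrm v.
Proof.
have -> : v + v = 2%:C *: v by rewrite rmorphD /= scalerDl scale1r.
by rewrite nrmZ ger0_norm // mulr_natl.
Qed.

Lemma cvg_nrmP {T : Type} {F : set_system T} {FF : Filter F} (f : T -> V) v :
  f x @[x --> F] --> v <-> nrm (f x - v) @[x --> F] --> (0 : R).
Proof.
split.
  move=> /cvgrPdist_lt h; apply/cvgr0Pnorm_lt => e e0.
  have : 0 < e%:C by rewrite (ltcR 0).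
  move=> /h; apply: filterS => x.
  by rewrite nrmE ltcR ger0_norm ?nrm_ge0 // nrmBC.
move=> /cvgr0Pnorm_lt h; apply/cvgrPdist_lt => e e0.
(* Positive elements of [R[i]] are real, so [e] is recovered from its real part. *)
have eE : (complex.Re e)%:C = e by apply: RRe_real; rewrite realE (ltW e0).
have : 0 < complex.Re e by rewrite -ltcR eE.
move=> /h; apply: filterS => x.
by rewrite nrmE -eE ltcR ger0_norm ?nrm_ge0 // nrmBC.
Qed.

Lemma eqfun_cvg_unique {T : Type} {F : set_system T} {FF : ProperFilter F}
    (f g : T -> V) v w :
  f =1 g -> f x @[x --> F] --> v -> g x @[x --> F] --> w -> v = w.
Proof. by move=> /funext ->; apply: cvg_unique; exact: norm_hausdorff. Qed.

Lemma continuous_lipschitz (f : R -> V) (K : R) :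
  (forall s t, nrm (f s - f t) <= K * `|s - t|) -> continuous f.
Proof.
move=> h t; apply/cvg_nrmP.
have hl : K * `|s - t| @[s --> t] --> (0 : R).
  rewrite -(mulr0 K) -[X in K * X](normr0 R) -(subrr t).
  by apply: cvgMr; apply: cvg_norm; apply: cvgB; [exact: cvg_id | exact: cvg_cst].
apply: (squeeze_cvgr _ (cvg_cst 0) hl).
by near=> s; rewrite nrm_ge0 h.
Unshelve. all: by end_near.
Qed.

End RealNorm.

(** * Algebraic identities and norm estimates in a C*-algebra *)

Section CstarAlgebra.
Context {R : realType} {B : completeNormedModType R[i]}
  {mul : B -> B -> B} {one : B} {star : B -> B}.
Hypothesis hB : is_unital_cstar_algebra mul one star.
Local Notation "x ** y" := (mul x y) (at level 40, left associativity).
Local Notation unitary := (cs_unitary mul one star).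
Implicit Types x y z u v w k g : B.

Lemma mul_oppl x y : (- x) ** y = - (x ** y).
Proof. by rewrite -scaleN1r (cs_mulZl hB) scaleN1r. Qed.

Lemma mul_oppr x y : x ** (- y) = - (x ** y).
Proof. by rewrite -scaleN1r (cs_mulZr hB) scaleN1r. Qed.

Lemma mul_zerol x : 0 ** x = 0.
Proof. by have := cs_mulZl hB 0 0 x; rewrite !scale0r. Qed.

Lemma mul_zeror x : x ** 0 = 0.
Proof. by have := cs_mulZr hB 0 x 0; rewrite !scale0r. Qed.

Lemma mul_subl x y z : (x - y) ** z = x ** z - y ** z.
Proof. by rewrite (cs_mulDl hB) mul_oppl. Qed.

Lemma mul_subr x y z : z ** (x - y) = z ** x - z ** y.
Proof. by rewrite (cs_mulDr hB) mul_oppr. Qed.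

Lemma star_opp x : star (- x) = - star x.
Proof. by rewrite -scaleN1r (cs_starZ hB) rmorphN1 scaleN1r. Qed.

Lemma star_sub x y : star (x - y) = star x - star y.
Proof. by rewrite (cs_starD hB) star_opp. Qed.

Lemma star_zero : star 0 = 0.
Proof. by rewrite -[in LHS](subrr 0) star_sub subrr. Qed.

Lemma star_scale_real (t : R) x : star (t%:C *: x) = t%:C *: star x.
Proof. by rewrite (cs_starZ hB); congr (_ *: _); exact: conjc_real. Qed.

Lemma star_one : star one = one.
Proof.
rewrite -[LHS](cs_mul1r hB) -{2}[one](cs_starK hB) -(cs_starM hB).
by rewrite (cs_mul1r hB) (cs_starK hB).
Qed.

Lemma nrmM x y : nrm (x ** y) <= nrm x * nrm y.
Proof. by rewrite -lecR rmorphM /= -!nrmE (cs_norm_mul hB). Qed.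

Lemma nrm_cstar x : nrm (star x ** x) = nrm x ^+ 2.
Proof. by apply: complexI; rewrite -nrmE (cs_cstar hB) nrmE rmorphXn. Qed.

(** The C*-identity gives [|y|^2 <= |star y| |y|]; cancelling [|y|] and taking both [y = x] and
    [y = star x] yields the two inequalities. *)
Lemma nrm_star x : nrm (star x) = nrm x.
Proof.
have H y : nrm y <= nrm (star y).
  have [y0|y0] := eqVneq (nrm y) 0; first by rewrite y0 nrm_ge0.
  have yp : 0 < nrm y by rewrite lt_neqAle eq_sym y0 nrm_ge0.
  by rewrite -(ler_pM2r yp) -expr2 -nrm_cstar nrmM.
by apply/le_anti; rewrite H -{2}[x](cs_starK hB) H.
Qed.

(** Only an inequality, because in the zero algebra the unit has norm [0]. *)
Lemma nrm_unitary u : unitary u -> nrm u <= 1.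
Proof.
have h1 : nrm one <= 1.
  have [|?] := leP (nrm one) 1 => //.
  have := nrm_cstar one; rewrite star_one (cs_mul1l hB) expr2; nra.
move=> [uu _]; have := nrm_cstar u; rewrite uu.
have := nrm_ge0 u; nra.
Qed.

Lemma unitary1 : unitary one.
Proof. by split; rewrite star_one (cs_mul1l hB). Qed.

Lemma unitary_star u : unitary u -> unitary (star u).
Proof. by move=> [? ?]; split; rewrite (cs_starK hB). Qed.

Lemma unitaryM u v : unitary u -> unitary v -> unitary (u ** v).
Proof.
move=> [u1 u2] [v1 v2]; split; rewrite (cs_starM hB).
  by rewrite -(cs_mulA hB) [star u ** _](cs_mulA hB) u1 (cs_mul1l hB).
by rewrite -(cs_mulA hB) [v ** (_ ** _)](cs_mulA hB) v2 (cs_mul1l hB).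
Qed.

Lemma cvg_mul {T : Type} {F : set_system T} {FF : Filter F} (f g : T -> B) x y :
  f t @[t --> F] --> x -> g t @[t --> F] --> y ->
  (f t ** g t) @[t --> F] --> x ** y.
Proof.
move=> /cvg_nrmP hf /cvg_nrmP hg; apply/cvg_nrmP.
have hl : nrm (f t - x) * nrm (g t - y) + nrm (f t - x) * nrm y
          + nrm x * nrm (g t - y) @[t --> F] --> (0 : R).
  have -> : (0 : R) = 0 * 0 + 0 * nrm y + nrm x * 0 by rewrite !mul0r mulr0 !addr0.
  by apply: cvgD; [apply: cvgD|]; apply: cvgM => //; exact: cvg_cst.
apply: (squeeze_cvgr _ (cvg_cst 0) hl).
near=> t; rewrite nrm_ge0 /=.
have -> : f t ** g t - x ** y =
    (f t - x) ** (g t - y) + (f t - x) ** y + x ** (g t - y).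
  by rewrite -(cs_mulDr hB) subrK mul_subl mul_subr addrA subrK.
by apply: le_trans (nrmD _ _) _; apply: lerD (nrmM _ _);
  apply: le_trans (nrmD _ _) _; apply: lerD (nrmM _ _); exact: nrmM.
Unshelve. all: by end_near.
Qed.

Lemma cvg_star {T : Type} {F : set_system T} {FF : Filter F} (f : T -> B) x :
  f t @[t --> F] --> x -> star (f t) @[t --> F] --> star x.
Proof.
move=> /cvg_nrmP hf; apply/cvg_nrmP.
rewrite [X in X @ _](_ : _ = fun t => nrm (f t - x)) //.
by apply/funext => t; rewrite -star_sub nrm_star.
Qed.

(** * Square roots near the unit by fixed-point iteration *)

Lemma mulsqB x y : x ** x - y ** y = x ** (x - y) + (x - y) ** y.
Proof. by rewrite mul_subr mul_subl addrA subrK. Qed.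

Lemma nrm_mulsqB x y (r : R) : nrm x <= r -> nrm y <= r ->
  nrm (x ** x - y ** y) <= (r + r) * nrm (x - y).
Proof.
move=> hx hy; rewrite mulsqB mulrDl; apply: le_trans (nrmD _ _) _.
by apply: lerD; apply: le_trans (nrmM _ _) _;
  [|rewrite mulrC]; rewrite ler_wpM2r ?nrm_ge0.
Qed.

(* The equation [2 x = x^2 + g] says that [1 - x] is a square root of [1 - g]. *)
Lemma sqrt_fixpoint_dist x y g g' : nrm x <= 2^-1 -> nrm y <= 2^-1 ->
  x + x = x ** x + g -> y + y = y ** y + g' -> nrm (x - y) <= nrm (g - g').
Proof.
move=> hx hy ex ey.
(* In the difference of the two equations the squares contribute at most [|x - y|], since both norms
   are at most 1/2; this absorbs one of the two copies of [x - y]. *)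
have e : (x - y) + (x - y) = (x ** x - y ** y) + (g - g').
  by rewrite addrACA -opprD ex ey opprD addrACA.
have := nrmDD (x - y); rewrite e => e2.
have := nrmD (x ** x - y ** y) (g - g').
have := nrm_mulsqB hx hy.
lra.
Qed.

Lemma sqrt_fixpoint_unique x y g : nrm x <= 2^-1 -> nrm y <= 2^-1 ->
  x + x = x ** x + g -> y + y = y ** y + g -> x = y.
Proof.
move=> hx hy ex ey; apply/subr0_eq/nrm_eq0/le_anti.
by rewrite nrm_ge0 -(nrm0 (V := B)) -(subrr g) (sqrt_fixpoint_dist hx hy ex ey).
Qed.

(** The iteration of [(x^2 + g) / 2] from [0] stays in the ball of radius 1/4, where this map is a
    contraction. The iterates are real polynomials in [g], so self-adjointness and commutation
    relations pass to the limit. *)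
Lemma sqrt_fixpoint g : nrm g <= 4^-1 -> exists x,
  [/\ nrm x <= 2^-1, x + x = x ** x + g, (star g = g -> star x = x) &
      forall y, y ** g = g ** y -> y ** x = x ** y].
Proof.
move=> hg.
pose X n : B := iter n (fun x => (2^-1 : R)%:C *: (x ** x + g)) 0.
have XS n : X n.+1 = (2^-1 : R)%:C *: (X n ** X n + g) by [].
have X2 n : X n.+1 + X n.+1 = X n ** X n + g.
  rewrite XS -scalerDl -rmorphD /=.
  have -> : (2^-1 + 2^-1 : R) = 1 by lra.
  by rewrite scale1r.
have Xb n : nrm (X n) <= 4^-1.
  elim: n => [|n IH]; first by rewrite /X /= nrm0; lra.
  have := nrmDD (X n.+1); rewrite X2.
  have := nrmD (X n ** X n) g; have := nrmM (X n) (X n).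
  have := nrm_ge0 (X n); nra.
have Xd n : nrm (X n.+1 - X n) <= 2^-1 ^+ n.
  elim: n => [|n IH].
    by rewrite /X /= subr0 mul_zerol add0r nrmZ expr0 ger0_norm; lra.
  have e : (X n.+2 - X n.+1) + (X n.+2 - X n.+1) = X n.+1 ** X n.+1 - X n ** X n.
    by rewrite addrACA -opprD !X2 opprD addrACA subrr addr0.
  have := nrmDD (X n.+2 - X n.+1); rewrite e exprS.
  have := nrm_mulsqB (Xb n.+1) (Xb n); have := nrm_ge0 (X n.+1 - X n); lra.
(* The bound is the exact sum of [2^-i] over [n <= i < m + n], so that the induction closes. *)
have Xc n m : nrm (X (m + n)%N - X n) <= 2 * 2^-1 ^+ n - 2 * 2^-1 ^+ (m + n).
  elim: m => [|m IH]; first by rewrite add0n !subrr nrm0.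
  have -> : X (m.+1 + n)%N - X n = (X (m + n).+1 - X (m + n)%N) + (X (m + n)%N - X n).
    by rewrite addrA subrK.
  apply: le_trans (nrmD _ _) _; have := Xd (m + n)%N.
  rewrite addSn exprS; lra.
have /cvg_ex[x Xx] : cvg (X @ \oo).
  apply/cauchy_cvgP/cauchy_exP => e e0.
  have eE : (complex.Re e)%:C = e by apply: RRe_real; rewrite realE (ltW e0).
  have e1 : 0 < complex.Re e / 2 by rewrite divr_gt0 // -ltcR eE.
  have /cvgr0Pnorm_lt/(_ _ e1) : (2^-1 : R) ^+ n @[n --> \oo] --> (0 : R).
    by apply: cvg_expr; rewrite ger0_norm; lra.
  move=> [n _ /(_ n (leqnn n)) /= hn].
  exists (X n); exists n => // m /= nm.
  rewrite -ball_normE /= nrmE -eE ltcR nrmBC -(subnK nm).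
  have := Xc n (m - n)%N.
  have : 0 <= (2^-1 : R) ^+ (m - n + n) by apply: exprn_ge0; lra.
  move: hn; rewrite ger0_norm; last by apply: exprn_ge0; lra.
  lra.
exists x; split.
(* The limit lies within 1/4 of some iterate, itself of norm at most 1/4. *)
- have h4 : (0 : R) < 4^-1 by lra.
  move/cvg_nrmP/cvgr0Pnorm_lt/(_ _ h4): (Xx) => [n _ /(_ n (leqnn n))/=].
  rewrite ger0_norm ?nrm_ge0 // => hn.
  have := nrmB (X n) (X n - x); rewrite opprB addrCA subrr addr0.
  have := Xb n; lra.
- have XSx : X n.+1 @[n --> \oo] --> x by rewrite cvg_shiftS.
  apply: (eqfun_cvg_unique (F := \oo) X2); first exact: cvgD.
  by apply: cvgD; [exact: cvg_mul | exact: cvg_cst].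
- move=> sg.
  have sX n : star (X n) = X n.
    elim: n => [|n IH]; first by rewrite /X /= star_zero.
    by rewrite XS star_scale_real (cs_starD hB) (cs_starM hB) IH sg.
  exact: (eqfun_cvg_unique (F := \oo) sX (cvg_star Xx) Xx).
- move=> y yg.
  have yX n : y ** X n = X n ** y.
    elim: n => [|n IH]; first by rewrite /X /= mul_zerol mul_zeror.
    rewrite XS (cs_mulZl hB) (cs_mulZr hB) (cs_mulDl hB) (cs_mulDr hB) yg.
    by rewrite (cs_mulA hB) IH -(cs_mulA hB) IH (cs_mulA hB).
  by apply: (eqfun_cvg_unique (F := \oo) yX); apply: cvg_mul => //; exact: cvg_cst.
Qed.

(* [k + (1 - x)] is the unitary with skew-adjoint part [k] and self-adjoint part
   [sqrt (1 + k^2)]. *)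
Lemma unitary_of_skew k x : star k = - k -> star x = x -> k ** x = x ** k ->
  x + x = x ** x - k ** k -> unitary (k + (one - x)).
Proof.
move=> sk sx kx ex.
set w := one - x.
have ww : w ** w = one + k ** k.
  rewrite /w mul_subl !mul_subr !(cs_mul1l hB) (cs_mul1r hB).
  have -> : x ** x = x + x + k ** k by rewrite ex subrK.
  by rewrite opprB -[x + x + _]addrA [x + (x + _) - x]addrAC subrr add0r addrA subrK.
have kw : k ** w = w ** k by rewrite /w mul_subl mul_subr (cs_mul1l hB) (cs_mul1r hB) kx.
have sE : star (k + w) = - k + w by rewrite (cs_starD hB) sk star_sub star_one sx.
clearbody w; split; rewrite sE (cs_mulDl hB) !(cs_mulDr hB) ww ?mul_oppl ?mul_oppr kw addrA.
  by rewrite subrK addrC addrK.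
by rewrite addrK addrC addrK.
Qed.

(** * Paths to the unit in the unitary group of a relative commutant *)

Section RelativeCommutant.
Context {A : completeNormedModType R[i]} {rho : A -> B} {S : set A}.
Local Notation G := (unitary_group_rel_commutant mul one star rho S).

Lemma rel_commutant1 : G one.
Proof. by split=> [|a _]; [exact: unitary1 | rewrite (cs_mul1l hB) (cs_mul1r hB)]. Qed.

Lemma rel_commutantM u v : G u -> G v -> G (u ** v).
Proof.
move=> [uu ur] [vu vr]; split=> [|a Sa]; first exact: unitaryM.
by rewrite -(cs_mulA hB) vr // (cs_mulA hB) ur // (cs_mulA hB).
Qed.

Lemma rel_commutant_star u : G u -> G (star u).
Proof.
move=> [uu ur]; split=> [|a Sa]; first exact: unitary_star.
have [u1 u2] := uu.
rewrite -[LHS](cs_mul1r hB) -u2 -(cs_mulA hB) [rho a ** _](cs_mulA hB) -ur //.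
by rewrite !(cs_mulA hB) u1 (cs_mul1l hB).
Qed.

(** Being constant outside [[0, 1]], such paths can be multiplied pointwise and, after shifts,
    strung together into an infinite product. *)
Definition joined_to_one u := exists f : R -> B,
  [/\ continuous f, forall t, G (f t),
      forall t, t <= 0 -> f t = one & forall t, 1 <= t -> f t = u].

Lemma joined_to_one1 : joined_to_one one.
Proof.
exists (fun=> one); split=> // [|_]; last exact: rel_commutant1.
by move=> t; exact: cvg_cst.
Qed.

Lemma joined_to_oneM u v :
  joined_to_one u -> joined_to_one v -> joined_to_one (u ** v).
Proof.
move=> [f [fc fG f0 f1]] [g [gc gG g0 g1]].
exists (fun t => f t ** g t); split.
- by move=> t; apply: cvg_mul; [exact: fc | exact: gc].
- by move=> t; exact: rel_commutantM.
- by move=> t t0; rewrite f0 // g0 // (cs_mul1l hB).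
- by move=> t t1; rewrite f1 // g1.
Qed.

Let clamp (t : R) : R := if t <= 0 then 0 else if t <= 1 then t else 1.

Let clamp0 t : t <= 0 -> clamp t = 0.
Proof. by move=> t0; rewrite /clamp t0. Qed.

Let clamp1 t : 1 <= t -> clamp t = 1.
Proof. by rewrite /clamp; case: (leP t 0); case: (leP t 1); lra. Qed.

Let clamp_bound t : 0 <= clamp t <= 1.
Proof. by rewrite /clamp; case: (leP t 0); case: (leP t 1); lra. Qed.

Let clamp_dist s t : `|clamp s - clamp t| <= `|s - t|.
Proof.
have := ler_norm (s - t); have := ler_norm (t - s); rewrite [`|t - s|]distrC.
rewrite /clamp => h1 h2; apply/ler_normlP.
case: (leP s 0); case: (leP s 1); case: (leP t 0); case: (leP t 1); split; lra.
Qed.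

(* With [k] the skew-adjoint part of [u], scaling [k] down to [0] moves [u] to
   [one] through the unitaries [t k + sqrt (1 + (t k)^2)]. *)
Lemma joined_to_one_near u : G u -> nrm (u - one) <= 2^-1 -> joined_to_one u.
Proof.
move=> Gu hu; have [[[u1 u2] ur] [_ usr]] := (Gu, rel_commutant_star Gu).
pose h : R[i] := (2^-1 : R)%:C.
have hh x : h *: x + h *: x = x.
  rewrite -scalerDl -rmorphD /=.
  have -> : (2^-1 + 2^-1 : R) = 1 by lra.
  by rewrite scale1r.
pose k := h *: (u - star u); pose p := h *: (u + star u).
have pk : p + k = u.
  by rewrite -scalerDr addrACA subrr addr0 scalerDr hh.
have pNk : p - k = star u.
  by rewrite -scalerBr opprB [u + _]addrC addrACA subrr addr0 scalerDr hh.
have sk : star k = - k by rewrite star_scale_real star_sub (cs_starK hB) -scalerN opprB.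
have kp : k ** p = p ** k.
  rewrite !(cs_mulZl hB, cs_mulZr hB) mul_subl mul_subr !(cs_mulDl hB, cs_mulDr hB).
  by rewrite u1 u2 !opprD !addrA addrK ?subrK.
have ppkk : p ** p = one + k ** k.
  have : (p - k) ** (p + k) = one by rewrite pk pNk.
  rewrite mul_subl !(cs_mulDr hB) kp opprD addrA addrK => <-.
  by rewrite subrK.
(* [x0] will be recognized as the fixed point at time [1]. Uniqueness requires its norm to be at
   most 1/2, which is where the closeness of [u] to [one] enters, besides the bound on [k]. *)
set x0 := one - p.
have nsB : nrm (star (u - one)) <= 2^-1 by rewrite nrm_star.
have x0p : x0 = one - p by [].
have x0E : x0 = - (h *: ((u - one) + star (u - one))).
  by rewrite star_sub star_one addrACA -opprD scalerBr opprB [h *: (one + one)]scalerDr hh.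
have nx0 : nrm x0 <= 2^-1.
  rewrite x0E nrmN nrmZ; have := nrmD (u - one) (star (u - one)).
  rewrite ger0_norm; lra.
have nk : nrm k <= 2^-1.
  have -> : k = h *: ((u - one) - star (u - one)).
    by rewrite star_sub star_one opprB addrA subrK.
  rewrite nrmZ; have := nrmB (u - one) (star (u - one)).
  rewrite ger0_norm; lra.
have ck y : y ** u = u ** y -> y ** star u = star u ** y -> y ** k = k ** y.
  by move=> yu yu'; rewrite /k (cs_mulZr hB) (cs_mulZl hB) mul_subr mul_subl yu yu'.
clearbody x0 k p.
pose kt t := (clamp t)%:C *: k.
have nkt t : nrm (kt t) <= 2^-1.
  rewrite nrmZ; have /andP[c0 c1] := clamp_bound t.
  by rewrite ger0_norm //; have := nrm_ge0 k; nra.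
have skt t : star (kt t) = - kt t by rewrite star_scale_real sk scalerN.
pose g t := - (kt t ** kt t).
have sg t : star (g t) = g t by rewrite star_opp (cs_starM hB) skt mul_oppl mul_oppr opprK.
have ckt y t : y ** k = k ** y -> y ** kt t = kt t ** y.
  by move=> yk; rewrite /kt (cs_mulZr hB) (cs_mulZl hB) yk.
have cg y t : y ** k = k ** y -> y ** g t = g t ** y.
  move=> yk; rewrite /g mul_oppl mul_oppr; congr (- _).
  by rewrite (cs_mulA hB) (ckt y) // -(cs_mulA hB) (ckt y) // (cs_mulA hB).
(* The fixed points are chosen separately for each [t]; continuity comes afterwards from their
   Lipschitz dependence on [g t]. *)
have /choice[X XP] t : exists x, [/\ nrm x <= 2^-1, x + x = x ** x + g t,
    star (g t) = g t -> star x = x & forall y, y ** g t = g t ** y -> y ** x = x ** y].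
  apply: sqrt_fixpoint; rewrite nrmN; apply: (le_trans (nrmM _ _)).
  have := nkt t; have := nrm_ge0 (kt t); nra.
have cX y t : y ** k = k ** y -> y ** X t = X t ** y.
  by move=> /(cg _ t); have [_ _ _] := XP t; apply.
exists (fun t => kt t + (one - X t)); split.
(* The summands [kt] and [X] each have Lipschitz constant 1/2: the first as [|k| <= 1/2], the second
   as squaring has constant 1 on the ball of radius 1/2. *)
- apply: (@continuous_lipschitz _ _ _ 1) => s t.
  rewrite mul1r opprD addrACA opprB.
  rewrite [one - X s + _]addrC [X t - one + _]addrA subrK; apply: le_trans (nrmD _ _) _.
  have [nXs Xs _ _] := XP s; have [nXt Xt _ _] := XP t.
  have := sqrt_fixpoint_dist nXt nXs Xt Xs.
  rewrite /g opprK [- (_ ** _) + _]addrC.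
  have := nrm_mulsqB (nkt s) (nkt t).
  have : nrm (kt s - kt t) <= 2^-1 * `|s - t|.
    rewrite -scalerBl -rmorphB /= nrmZ.
    by have := clamp_dist s t; have := normr_ge0 (clamp s - clamp t); nra.
  lra.
- move=> t; split.
    have [_ Xt Xs _] := XP t; apply: unitary_of_skew => //; first exact: Xs.
    by apply: cX; rewrite ckt.
  move=> a Sa.
  (* Commutation with [u] and [star u] passes to [k] and from there to the root [X t]. *)
  have kr : rho a ** k = k ** rho a.
    by apply: ck; rewrite ?ur ?usr.
  rewrite (cs_mulDl hB) (cs_mulDr hB) mul_subl mul_subr (cX _ _ kr).
  by rewrite (cs_mul1l hB) (cs_mul1r hB) ckt.
- move=> t t0; have k0 : kt t = 0 by rewrite /kt clamp0 // scale0r.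
  have [nX Xt _ _] := XP t.
  have -> : X t = 0.
    apply: (sqrt_fixpoint_unique nX _ Xt); first by rewrite nrm0 invr_ge0.
    by rewrite /g k0 mul_zerol oppr0 !addr0.
  by rewrite k0 add0r subr0.
- move=> t t1; have k1 : kt t = k by rewrite /kt clamp1 // scale1r.
  have [nX Xt _ _] := XP t.
  have -> : X t = x0.
    apply: (sqrt_fixpoint_unique nX nx0 Xt).
    rewrite /g k1 x0p mul_subl !mul_subr !(cs_mul1l hB) (cs_mul1r hB) ppkk.
    by rewrite opprB -[RHS]addrA; congr (_ + _); rewrite addrAC addrK.
  by rewrite k1 x0p subKr addrC.
Qed.

Lemma joined_to_one_commutant u : joined_to_one u -> G u.
Proof. by move=> [f [_ fG _ f1]]; rewrite -(f1 1). Qed.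

(** Translation by [star u] moves [v] to within 1/2 of [one], so a single radius works around every
    point. *)
Lemma joined_to_one_close u v :
  joined_to_one u -> G v -> nrm (v - u) <= 2^-1 -> joined_to_one v.
Proof.
move=> ju Gv uv; have Gu := joined_to_one_commutant ju.
have [[u1 u2] _] := Gu.
have -> : v = u ** (star u ** v) by rewrite (cs_mulA hB) u2 (cs_mul1l hB).
apply: joined_to_oneM => //; apply: joined_to_one_near.
  by apply: rel_commutantM => //; exact: rel_commutant_star.
rewrite -u1 -mul_subr; apply: le_trans (nrmM _ _) _; rewrite nrm_star.
have := nrm_unitary (conj u1 u2); have := nrm_ge0 u; have := nrm_ge0 (v - u); nra.
Qed.

Lemma connected_joined_to_one : connected G -> forall u, G u -> joined_to_one u.
Proof.
move=> Gc; suff <- : [set u | joined_to_one u] = G by [].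
have e0 : 0 < (2^-1 : R)%:C by rewrite (ltcR 0) invr_gt0.
(* This serves twice: for relative openness, and for relative closedness, as a limit point lies in
   such a ball around a joined element. *)
have cl u v : joined_to_one u -> G v -> ball u (2^-1 : R)%:C v -> joined_to_one v.
  move=> ju Gv; rewrite -ball_normE /= nrmE ltcR nrmBC => /ltW.
  exact: joined_to_one_close.
apply: Gc.
- by exists one; exact: joined_to_one1.
- exists (\bigcup_(u in [set u | joined_to_one u]) ball u (2^-1 : R)%:C).
    by apply: bigcup_open => u _; exact: ball_open.
  apply/seteqP; split=> [u ju|v [Gv [u ju uv]]]; last exact: cl uv.
  by split; [exact: joined_to_one_commutant | exists u => //; exact: ballxx].
- exists (closure [set u | joined_to_one u]); first exact: closed_closure.
  apply/seteqP; split=> [u ju|v [Gv]].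
    by split; [exact: joined_to_one_commutant | exact: subset_closure].
  move=> /(_ _ (nbhsx_ballx v _ e0)) [u [ju /ball_sym uv]].
  exact: cl uv.
Qed.

End RelativeCommutant.

End CstarAlgebra.

(** * Boundedness of unital *-homomorphisms *)

Section StarHomomorphism.
Context {R : realType} {A B : completeNormedModType R[i]}
  {mulA : A -> A -> A} {oneA : A} {starA : A -> A}
  {mulB : B -> B -> B} {oneB : B} {starB : B -> B} {f : A -> B}.
Hypothesis hA : is_unital_cstar_algebra mulA oneA starA.
Hypothesis hB : is_unital_cstar_algebra mulB oneB starB.
Hypothesis hf : is_unital_star_hom mulA oneA starA mulB oneB starB f.

Lemma star_homD a b : f (a + b) = f a + f b.
Proof. by case: hf. Qed.

Lemma star_homZ (c : R[i]) a : f (c *: a) = c *: f a.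
Proof. by case: hf. Qed.

Lemma star_homB a b : f (a - b) = f a - f b.
Proof. by rewrite star_homD -[- b]scaleN1r star_homZ scaleN1r. Qed.

Lemma star_hom_unitary u :
  cs_unitary mulA oneA starA u -> cs_unitary mulB oneB starB (f u).
Proof. by case: hf => _ _ fM fS f1 [u1 u2]; split; rewrite -fS -fM ?u1 ?u2. Qed.

(* A small skew-adjoint element is half the difference of a unitary and its
   adjoint, and unitaries are sent to unitaries. *)
Lemma nrm_star_hom_small_skew k :
  starA k = - k -> nrm k <= 2^-1 -> nrm (f k) <= 1.
Proof.
move=> sk nk.
have [|x [_ xE xs xk]] := sqrt_fixpoint hA (g := - mulA k k).
  rewrite nrmN; apply: (le_trans (nrmM hA _ _)); have := nrm_ge0 k; nra.
have {}xs : starA x = x.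
  by apply: xs; rewrite (star_opp hA) (cs_starM hA) sk (mul_oppl hA) (mul_oppr hA) opprK.
have {}xk : mulA k x = mulA x k.
  by apply: xk; rewrite (mul_oppl hA) (mul_oppr hA) (cs_mulA hA).
have uu := unitary_of_skew hA sk xs xk xE.
have kE : k + k = (k + (oneA - x)) - starA (k + (oneA - x)).
  by rewrite (cs_starD hA) sk (star_sub hA) (star_one hA) xs opprD opprK addrACA subrr addr0.
have := star_hom_unitary uu; have [_ _ _ fS _] := hf.
move: kE; set u := k + (oneA - x) => kE fu.
have := nrmDD (f k); rewrite -star_homD kE star_homB fS => e.
have := nrmB (f u) (starB (f u)); rewrite e (nrm_star hB).
have := nrm_unitary hB fu; lra.
Qed.

Lemma nrm_star_hom_skew k : starA k = - k -> nrm (f k) <= 2 * nrm k.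
Proof.
move=> sk; have [k0|k0] := eqVneq (nrm k) 0.
  by rewrite (nrm_eq0 k0) -[in f _](subrr 0) star_homB subrr !nrm0 mulr0.
have kp : 0 < nrm k by rewrite lt_neqAle eq_sym k0 nrm_ge0.
(* Rescaling by [t] gives [k] norm exactly 1/2. *)
pose t := (2 * nrm k)^-1.
have t0 : 0 < t by rewrite invr_gt0 mulr_gt0.
have : nrm (f (t%:C *: k)) <= 1.
  apply: nrm_star_hom_small_skew; first by rewrite (star_scale_real hA) sk scalerN.
  by rewrite nrmZ gtr0_norm // /t invfM -mulrA mulVf ?mulr1.
rewrite star_homZ nrmZ gtr0_norm // mulrC -ler_pdivlMr // div1r /t invrK.
by [].
Qed.

(** Both [a - starA a] and ['i *: (a + starA a)] are skew-adjoint of norm at most [2 |a|], whence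
    [2 |f a| <= 8 |a|]. *)
Lemma nrm_star_hom a : nrm (f a) <= 4 * nrm a.
Proof.
have skew_im : starA (a - starA a) = - (a - starA a).
  by rewrite (star_sub hA) (cs_starK hA) opprB.
have skew_re : starA ('i *: (a + starA a)) = - ('i *: (a + starA a)).
  rewrite (cs_starZ hA) (cs_starD hA) (cs_starK hA) addrC -scaleNr.
  by congr (_ *: _); apply/eqP; rewrite eq_complex /= oppr0 !eqxx.
have im_le := nrm_star_hom_skew skew_im; have re_le := nrm_star_hom_skew skew_re.
have aE : a + a = (a + starA a) + (a - starA a).
  by rewrite addrACA subrr addr0.
have := nrmDD (f a); rewrite -star_homD aE star_homD => e.
have := nrmD (f (a + starA a)) (f (a - starA a)).
have := nrmB a (starA a); have := nrmD a (starA a).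
move: re_le; rewrite star_homZ !nrmZi (nrm_star hA); lra.
Qed.

End StarHomomorphism.

(** * Concatenation of infinitely many paths of unitaries *)

Section InfinitePath.
Context {R : realType} {B : completeNormedModType R[i]} {mul : B -> B -> B}
  {one : B} {star : B -> B} (U : nat -> B) (f : nat -> R -> B).
Hypothesis hB : is_unital_cstar_algebra mul one star.
Hypothesis hU : forall n, cs_unitary mul one star (U n).
Hypothesis fc : forall n, continuous (f n).
Hypothesis fU : forall n t, cs_unitary mul one star (f n t).
Hypothesis f0 : forall n t, t <= 0 -> f n t = one.
Hypothesis f1 : forall n t, 1 <= t -> f n t = mul (star (U n)) (U n.+1).

Fixpoint partial_path n (s : R) : B :=
  if n is m.+1 then mul (partial_path m s) (f m (s - m%:R)) else U 0.

(* All factors of index larger than [s] are [one] at [s], so this is the infinite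
   product [U 0 * f 0 s * f 1 (s - 1) * ...]; it passes through [U n] at time [n]. *)
Definition infinite_path (s : R) : B := partial_path (Num.truncn s).+1 s.

Lemma partial_path_unitary n s : cs_unitary mul one star (partial_path n s).
Proof. by elim: n => [|n IH] //=; exact: unitaryM. Qed.

Lemma continuous_partial_path n : continuous (partial_path n).
Proof.
elim: n => [|n IH] s /=; first exact: cvg_cst.
apply: (cvg_mul hB); first exact: IH.
apply: continuous_comp; last exact: fc.
by apply: cvgB; [exact: cvg_id | exact: cvg_cst].
Qed.

Lemma partial_path_stable m n s : s <= n%:R -> partial_path (m + n) s = partial_path n s.
Proof.
move=> sn; elim: m => [|m IH] //=; rewrite IH f0 ?(cs_mul1r hB) //.
by rewrite subr_le0 (le_trans sn) // ler_nat leq_addl.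
Qed.

Lemma infinite_pathE n s : s < n%:R -> infinite_path s = partial_path n s.
Proof.
move=> sn; rewrite /infinite_path; have st := truncnS_gt s.
have [le|/ltnW le] := leqP n (Num.truncn s).+1.
  by rewrite -{1}(subnK le) partial_path_stable ?ltW.
by rewrite -[in RHS](subnK le) partial_path_stable ?ltW.
Qed.

Lemma infinite_path_unitary s : cs_unitary mul one star (infinite_path s).
Proof. exact: partial_path_unitary. Qed.

(** Near each time the path coincides with a single finite product. *)
Lemma continuous_infinite_path : continuous infinite_path.
Proof.
move=> s; have sn := truncnS_gt s; set n := (Num.truncn s).+1 in sn.
rewrite /continuous_at (infinite_pathE sn).
apply: cvg_trans (@continuous_partial_path n s).
apply: near_eq_cvg; near=> r; apply/esym/infinite_pathE.
by near: r; exact: lt_nbhsl.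
Unshelve. all: by end_near.
Qed.

(** All factors have reached their endpoints, and [U 0 (U 0)^* U 1 (U 1)^* U 2 ...] telescopes. *)
Lemma partial_path_node n s : n%:R <= s -> partial_path n s = U n.
Proof.
elim: n => [|n IH] //= ns; rewrite IH; last by rewrite (le_trans _ ns) // ler_nat.
rewrite f1; last by rewrite lerBrDl -natr1 in ns *.
by rewrite (cs_mulA hB) (proj2 (hU n)) (cs_mul1l hB).
Qed.

(** From time [n] on the product is [U n] followed by factors of index at least [n]; these commute
    with [r], so conjugating by them leaves [r] fixed. *)
Lemma infinite_path_tail n (p r : B) s : n%:R <= s ->
  mul (mul (star (U n)) p) (U n) = r ->
  (forall m t, (n <= m)%N -> mul (f m t) r = mul r (f m t)) ->
  mul (mul (star (infinite_path s)) p) (infinite_path s) = r.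
Proof.
move=> ns Ur fr.
have partialE m : mul (mul (star (partial_path (m + n) s)) p) (partial_path (m + n) s) = r.
  elim: m => [|m IH]; first by rewrite partial_path_node.
  rewrite addSn /= (cs_starM hB).
  set g := f _ _; set q := partial_path _ _ in IH *.
  have -> : mul (mul (mul (star g) (star q)) p) (mul q g)
      = mul (star g) (mul (mul (mul (star q) p) q) g) by rewrite !(cs_mulA hB).
  by rewrite IH -fr ?leq_addl // (cs_mulA hB) (proj1 (fU _ _)) (cs_mul1l hB).
rewrite /infinite_path -(@subnK n (Num.truncn s).+1) //.
by rewrite ltnW // -(ltr_nat R) (le_lt_trans ns) ?truncnS_gt.
Qed.

End InfinitePath.

(** * Assembly of the strong internal path *)

Theorem mainTheorem7 (R : realType)
    (A : completeNormedModType R[i])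
    (mulA : A -> A -> A) (oneA : A) (starA : A -> A)
    (B : completeNormedModType R[i])
    (mulB : B -> B -> B) (oneB : B) (starB : B -> B)
    (An : nat -> set A) (pi rho : A -> B) :
  is_unital_cstar_algebra mulA oneA starA ->
  separable A ->
  is_unital_cstar_algebra mulB oneB starB ->
  (forall n : nat, is_cstar_subalgebra mulA starA (An n)) ->
  (forall n : nat, An n `<=` An n.+1) ->
  closure (\bigcup_n An n) = setT ->
  is_unital_star_hom mulA oneA starA mulB oneB starB pi ->
  is_unital_star_hom mulA oneA starA mulB oneB starB rho ->
  (forall n : nat, exists U : B, cs_unitary mulB oneB starB U /\
     forall a, An n a -> mulB (mulB (starB U) (pi a)) U = rho a) ->
  (forall n : nat, connected (unitary_group_rel_commutant mulB oneB starB rho (An n))) ->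
  strong_internal_path mulB oneB starB pi rho.
Proof.
move=> hA _ hB _ AnS Andense hpi hrho /choice[U hU] Gconn.
have Unitary_U n : cs_unitary mulB oneB starB (U n) by case: (hU n).
have An_le m n : (m <= n)%N -> An m `<=` An n.
  move=> /subnK <-; elim: (n - m)%N => [|j IH] //.
  exact: subset_trans IH (AnS _).
have UU n : unitary_group_rel_commutant mulB oneB starB rho (An n)
    (mulB (starB (U n)) (U n.+1)).
  split; first by apply: (unitaryM hB) => //; exact: (unitary_star hB).
  move=> a An_a; have [[u1 u2] Ur] := hU n; have [[v1 v2] Vr] := hU n.+1.
  (* Writing [rho a] through [U n.+1] on the left and through [U n] on the right turns both sides
     into [(U n)^* (pi a) (U n.+1)]. *)
  rewrite -{1}(Vr a (AnS _ _ An_a)) -(Ur a An_a) !(cs_mulA hB).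
  rewrite -(cs_mulA hB _ (U n.+1) (starB _)) v2 (cs_mul1r hB).
  by rewrite -(cs_mulA hB _ (U n) (starB _)) u2 (cs_mul1r hB).
have /choice[f hf] n := connected_joined_to_one hB (@Gconn n) (UU n).
have fc n : continuous (f n) by case: (hf n).
have fG n t : unitary_group_rel_commutant mulB oneB starB rho (An n) (f n t).
  by case: (hf n).
have fU n t : cs_unitary mulB oneB starB (f n t) by case: (fG n t).
have f0 n t : t <= 0 -> f n t = oneB by case: (hf n) => _ _ h _; exact: h.
have f1 n t : 1 <= t -> f n t = mulB (starB (U n)) (U n.+1).
  by case: (hf n) => _ _ _; exact.
(* The function [t / (1 - t)] maps [[0, 1)] increasingly onto [[0, oo)]. *)
exists (fun t => infinite_path (mul := mulB) U f (t / (1 - t))); split; [|split].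
- by move=> t _; exact: (infinite_path_unitary hB).
- apply/subspace_continuousP => t; rewrite /= in_itv /= => /andP[_ t1].
  apply: cvg_within_filter.
  apply: (@continuous_comp _ _ _ (fun t : R => t / (1 - t)) (infinite_path U f)).
    apply: cvgM; first exact: cvg_id.
    apply: cvgV; first by rewrite subr_eq0 gt_eqF.
    by apply: cvgB; [exact: cvg_cst | exact: cvg_id].
  exact: (continuous_infinite_path hB).
- move=> a; apply/cvg_nrmP/cvgr0Pnorm_lt => e e0.
  (* The final error is at most [(4 + 4) |a - b|], one 4 from each homomorphism, hence below
     [e / 2]. *)
  have d0 : 0 < (e / 16 : R)%:C by rewrite (ltcR 0) divr_gt0.
  have : closure (\bigcup_n An n) a by rewrite Andense.
  move=> /(_ _ (nbhsx_ballx a _ d0)) [b [[n _ Anb]]].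
  rewrite -ball_normE /= nrmE ltcR => ab.
  have tail_b s : n%:R <= s ->
      mulB (mulB (starB (infinite_path (mul := mulB) U f s)) (pi b))
        (infinite_path (mul := mulB) U f s) = rho b.
    move=> ns; apply: (infinite_path_tail hB Unitary_U fU f1 ns).
      by have [_] := hU n; apply.
    by move=> m t nm; case: (fG m t) => _; apply; exact: An_le nm _ Anb.
  near=> t.
  have t1 : t < 1 by near: t; exact: nbhs_left_lt.
  (* [n / (n + 1)] is the parameter that [t / (1 - t)] sends to [n]. *)
  have nt : n%:R / n.+1%:R < t.
    by near: t; apply: nbhs_left_gt; rewrite ltr_pdivrMr ?mul1r ?ltr_nat.
  have ns : n%:R <= t / (1 - t).
    rewrite ler_pdivlMr ?subr_gt0 //; move: nt.
    by rewrite ltr_pdivrMr // -natr1; nra.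
  rewrite ger0_norm ?nrm_ge0 //.
  have gU := infinite_path_unitary (f := f) hB Unitary_U fU (t / (1 - t)).
  move: (tail_b _ ns) gU; set g := infinite_path _ _ _ => gb gU.
  (* The error vanishes at [b] and is additive, so it depends only on [a - b]. *)
  have -> : mulB (mulB (starB g) (pi a)) g - rho a
      = mulB (mulB (starB g) (pi (a - b))) g - rho (a - b).
    rewrite (star_homB hpi) (star_homB hrho) (mul_subr hB) (mul_subl hB) gb.
    by rewrite opprB addrA subrK.
  have := nrmB (mulB (mulB (starB g) (pi (a - b))) g) (rho (a - b)).
  have := nrm_star_hom hA hB hrho (a - b); have := nrm_star_hom hA hB hpi (a - b).
  have := nrmM hB (mulB (starB g) (pi (a - b))) g.
  have := nrmM hB (starB g) (pi (a - b)); rewrite (nrm_star hB).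
  have := nrm_unitary hB gU; have := nrm_ge0 g.
  have := nrm_ge0 (mulB (starB g) (pi (a - b))); have := nrm_ge0 (pi (a - b)).
  move: (nrm g) (nrm (mulB _ _)) (nrm (pi _)) (nrm (a - b)) ab => x y z w.
  nra.
Unshelve. all: by end_near.
Qed.
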